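(* Let $G$ be a finite connected bipartite graph whose two parts have sizes $n$ and $m$, and suppose $G$ is one-side regular, i.e. all vertices in at least one of the two parts have the same degree. Let $D(G)$ be the product of the degrees of all vertices of $G$ and $\tau(G)$ the number of spanning trees of $G$. Then $$\tau(G)\le \frac{D(G)}{mn}.$$
   Context: $\tau(G)$ denotes the number of spanning trees of $G$; if the degrees in the first part are $a_1,\dots,a_n$ and in the second part $b_1,\dots,b_m$, then $D(G)=a_1\cdots a_n\, b_1\cdots b_m$. *)

(* Defs.v *)
From mathcomp Require Import all_boot.

Set Implicit Arguments.
Unset Strict Implicit.
Unset Printing Implicit Defensive.

(* A finite simple graph is a symmetric irreflexive relation on a finType;
   both properties are assumed where they are needed. *)

Section SimpleGraphs.

Variable T : finType.
Implicit Types (e : rel T) (F : {set {set T}}) (A B : {set T}).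

Definition deg e (x : T) : nat := #|[set y | e x y]|.

Definition deg_prod e : nat := \prod_(x : T) deg e x.

(* The empty graph satisfies this. *)
Definition graph_connected e : bool :=
  [forall x, [forall y, connect e x y]].

(* Cycles have length at least 3.  A cycle has no repeated vertex, so its
   length is at most #|T|, which makes the condition decidable; see acyclicP. *)
Definition acyclic e : bool :=
  [forall k : 'I_(#|T|.+1),
    [forall c : k.-tuple T, ~~ [&& 2 < size c, uniq c & cycle e c]]].

Lemma acyclicP e :
  reflect (forall c : seq T, uniq c -> cycle e c -> size c <= 2) (acyclic e).
Proof.
apply: (iffP idP) => [/forallP H c Uc Cc | H].
  have lt_c : size c < #|T|.+1 by rewrite ltnS -(card_uniqP Uc) max_card.
  have /forallP/(_ (in_tuple c)) := H (Ordinal lt_c).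
  by rewrite /= Uc Cc !andbT -leqNgt.
apply/forallP=> k; apply/forallP=> c; apply/negP=> /and3P[lt2 Uc Cc].
by have := H c Uc Cc; rewrite leqNgt lt2.
Qed.

Definition edges e : {set {set T}} :=
  [set [set p.1; p.2] | p : T * T & e p.1 p.2].

Definition edge_rel F : rel T := fun x y => [set x; y] \in F.

(* A spanning tree is identified with its edge set. *)
Definition spanning_trees e : {set {set {set T}}} :=
  [set F : {set {set T}} | [&& F \subset edges e,
      graph_connected (edge_rel F) & acyclic (edge_rel F)]].

Definition num_spanning_trees e : nat := #|spanning_trees e|.

Definition bipartition e A B : Prop :=
  [/\ A :|: B = [set: T], [disjoint A & B] &
      forall x y, e x y ->
        (x \in A) && (y \in B) || (x \in B) && (y \in A)].

Definition regular_on e A : Prop :=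
  exists d : nat, forall x, x \in A -> deg e x = d.

Definition one_side_regular e A B : Prop := regular_on e A \/ regular_on e B.

End SimpleGraphs.

(* Main.v *)
(* Let A be the side on which all degrees equal d, let M be the biadjacency
   matrix and D_B the diagonal matrix of the degrees on the side B.  Expanding
   the determinant of the Laplacian with row r replaced by the unit vector e_r
   over the choices of one neighbour per vertex bounds tau(G) by it (one half of
   the matrix-tree theorem).  For r in A, eliminating B by a Schur complement
   gives det(D_B) * det(Q_r), where Q = d I - M D_B^-1 M^T and Q_r is Q with row
   r replaced by e_r; moreover det(Q + (d/n) J) = d n det(Q_r).  The matrix
   S = M D_B^-1 M^T / d is doubly stochastic and positive semidefinite with trace
   m/d, so the eigenvalues x_i of S - J/n lie in [0, 1] and sum to m/d - 1.  The
   theorem is then the inequality prod (1 - x_i) * (1 + sum x_i) <= 1. *)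
Require Import Defs.
From HB Require Import structures.
From mathcomp Require Import all_boot all_order all_fingroup all_algebra all_field ring.
Set Implicit Arguments.
Unset Strict Implicit.
Unset Printing Implicit Defensive.
Import Order.TTheory GRing.Theory Num.Theory.
Local Open Scope ring_scope.

(** * Determinants of parent functions *)

(** The Laplacian of the functional digraph of [f], with row [r] replaced by a unit vector, so that
    [r] acts as a root without parent. *)
Definition parent_mx (R : pzRingType) N (r : 'I_N) (f : 'I_N -> 'I_N) : 'M[R]_N :=
  \matrix_(i, j) ((i == j)%:R - ((i != r) && (f i == j))%:R).

(** [h] counts the steps of [f] up to the first visit to [r]. *)
Lemma iter_rank (T : finType) (f : T -> T) (r : T) :
    (forall i, fconnect f i r) ->
  exists h : T -> nat, forall i, i != r -> (h (f i) < h i)%N.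
Proof.
move=> reach.
have ex i : exists k, iter k f i == r.
  by have := reach i => /iter_findex fi; exists (findex f i r); rewrite fi.
exists (fun i => ex_minn (ex i)) => i ir.
case: ex_minnP => k _ kmin; case: ex_minnP => -[|l] /eqP il lmin.
  by rewrite -il eqxx in ir.
by rewrite ltnS; apply: kmin; rewrite -iterSr il.
Qed.

(** Sorted by the rank of [iter_rank], the matrix is triangular with unit diagonal. *)
Lemma det_parent_mx_tree (R : comPzRingType) N (r : 'I_N) (f : 'I_N -> 'I_N) :
  (forall i, fconnect f i r) -> \det (parent_mx R r f) = 1.
Proof.
move=> /iter_rank[h hf].
rewrite /determinant (bigD1 (1%g : 'S_N)) //= [X in _ + X]big1 => [|s s1].
  rewrite addr0 odd_perm1 expr0 mul1r big1 // => i _.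
  rewrite mxE perm1 eqxx; case: eqP => [|/eqP ir]; rewrite ?subr0 //=.
  by case: eqP (hf i ir) => [->|]; rewrite ?ltnn ?subr0.
(* In a nonzero term each [s i] is [i] or [f i], so [s] never increases [h]; a
   permutation preserves the sum of [h], hence fixes every point. *)
have [/forallP sf|/forallPn[i]] :=
  boolP [forall i, (s i == i) || (i != r) && (f i == s i)]; last first.
  rewrite negb_or => /andP[si fi].
  by rewrite (bigD1 i) //= mxE eq_sym (negbTE si) (negbTE fi) subr0 mul0r mulr0.
have h_le i : (h (s i) <= h i)%N.
  by case/orP: (sf i) => [/eqP->//|/andP[ir /eqP<-]]; rewrite ltnW ?hf.
have [i si] : exists i, s i != i.
  apply/existsP; apply: contraNT s1 => /existsPn sid; apply/eqP/permP => i.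
  by rewrite perm1; apply/eqP/negPn/sid.
have: (\sum_j h (s j) < \sum_j h j)%N.
  rewrite (bigD1 i) //= [X in (_ < X)%N](bigD1 i) //= -addSn.
  apply: leq_add; last by apply: leq_sum.
  by case/orP: (sf i) => [|/andP[ir /eqP<-]]; [rewrite (negbTE si)|apply: hf].
by rewrite [X in (_ < X)%N](reindex_inj (@perm_inj _ s)) ltnn.
Qed.

Lemma det_parent_mx_cycle (R : idomainType) N (r : 'I_N) (f : 'I_N -> 'I_N) i0 :
  ~~ fconnect f i0 r -> f r = r -> \det (parent_mx R r f) = 0.
Proof.
move=> i0r fr; apply/eqP; rewrite -det_tr; apply/det0P.
(* The points that never reach [r] form a set stable by [f] and [f^-1]. *)
exists (\row_i (~~ fconnect f i r)%:R).
  by apply/eqP => /rowP/(_ i0); rewrite !mxE i0r => /eqP; rewrite oner_eq0.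
apply/rowP => i; rewrite !mxE.
under eq_bigr => j _ do rewrite !mxE mulrBr.
rewrite sumrB (bigD1 i) //= eqxx mulr1 big1 ?addr0 => [|j ji]; last first.
  by rewrite eq_sym (negbTE ji) mulr0.
rewrite (bigD1 (f i)) //= eqxx andbT big1 ?addr0 => [|j ji]; last first.
  by rewrite [f i == j]eq_sym (negbTE ji) andbF mulr0.
have [->|ir] := eqVneq i r; first by rewrite connect0 fr connect0 mulr0 subr0.
rewrite mulr1; apply/eqP; rewrite subr_eq0; apply/eqP; congr (~~ _)%:R.
apply/idP/idP => [|fir]; last by rewrite (connect_trans (fconnect1 f i)).
move=> /iter_findex; case: findex => [/= ir0|k]; first by rewrite ir0 eqxx in ir.
by rewrite iterSr => <-; apply: fconnect_iter.
Qed.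

(** * Half of the matrix-tree theorem *)

(** [h] is the distance to [r] along [c], and [f] moves to a vertex closer to [r]. *)
Lemma connect_parent (T : finType) (c : rel T) (r : T) :
    (forall x, connect c x r) ->
  exists (f : T -> T) (h : T -> nat),
    forall x, x != r -> c x (f x) /\ (h (f x) < h x)%N.
Proof.
move=> conn.
have ex x : exists k, [exists p : k.-tuple T, path c x p && (last x p == r)].
  have /connectP[p cp rE] := conn x.
  by exists (size p); apply/existsP; exists (in_tuple p); rewrite cp -rE eqxx.
pose h x := ex_minn (ex x).
have step x : x != r -> exists y, c x y && (h y < h x)%N.
  rewrite {2}/h; case: ex_minnP => k /existsP[[p /= /eqP<-]].
  case: p => [|y p] /=; first by move=> /eqP->; rewrite eqxx.
  move=> /andP[/andP[cxy cp] rE] _ _; exists y; rewrite cxy ltnS /h.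
  case: ex_minnP => l _; apply; apply/existsP; exists (in_tuple p).
  by rewrite cp.
exists (fun x => odflt x [pick y | c x y && (h y < h x)%N]), h => x xr.
case: pickP => [y /andP[]//|no]; have [y] := step x xr.
by rewrite no.
Qed.

Lemma rank_connect (T : finType) (c : rel T) (r : T) (f : T -> T) (h : T -> nat) :
    (forall x, x != r -> c x (f x) /\ (h (f x) < h x)%N) ->
  forall x, connect c x r.
Proof.
move=> cf x; have [k] := ubnP (h x); elim: k x => // k IHk x.
have [->|xr] := eqVneq x r; first by rewrite connect0.
have [cx hx] := cf x xr; rewrite ltnS => hk.
exact: connect_trans (connect1 cx) (IHk _ (leq_trans hx hk)).
Qed.

Section SpanningTrees.

Variables (T : finType) (e : rel T).
Hypotheses (e_sym : symmetric e) (e_irr : irreflexive e).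

Lemma edge_rel_sym (F : {set {set T}}) : symmetric (edge_rel F).
Proof. by move=> x y; rewrite /edge_rel setUC. Qed.

Lemma edge_rel_sub (F : {set {set T}}) :
  F \subset edges e -> subrel (edge_rel F) e.
Proof.
move=> /subsetP Fe x y /Fe/imsetP[[a b]]; rewrite inE /= => eab xyE.
have : a \in [set x; y] by rewrite xyE set21.
have : b \in [set x; y] by rewrite xyE set22.
have ab : a != b by apply: contraTneq eab => ->; rewrite e_irr.
rewrite !inE => /orP[]/eqP bE /orP[]/eqP aE; move: ab eab; rewrite bE aE ?eqxx //.
by rewrite e_sym.
Qed.

(** An edge of [F] outside [F'] would be closed by a path of [F'] into a cycle of [F]. *)
Lemma acyclic_connected_minimal (F F' : {set {set T}}) :
    F \subset edges e -> acyclic (edge_rel F) ->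
    F' \subset F -> graph_connected (edge_rel F') ->
  F = F'.
Proof.
move=> Fe /acyclicP acyF F'F connF'; apply/eqP; rewrite eqEsubset F'F andbT.
apply/subsetP => z zF; apply: contraT => zF'.
have /imsetP[[x y]] := subsetP Fe z zF; rewrite inE /= => exy zE.
have /connectP[p0 p0P] := forallP (forallP connF' x) y.
case/shortenP: p0P => p cp Up _ yE.
have cF : path.cycle (edge_rel F) (x :: p).
  rewrite /= rcons_path -yE (sub_path _ cp) => [|a b]; last exact: (subsetP F'F).
  by rewrite edge_rel_sym /edge_rel -zE.
(* The cycle has length at least 3: a path with one vertex would make the edge a loop, one with two
   vertices would put it in [F']. *)
have := acyF _ Up cF; case: p cp yE {Up cF} => [|u [|v p]] //=.
  by move=> _ xy; rewrite xy e_irr in exy.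
by move=> + yE; rewrite andbT -yE /edge_rel -zE (negbTE zF').
Qed.

(** Orient the tree towards [r]: the parent edges already connect all vertices, so by minimality
    they exhaust [F]. *)
Lemma spanning_tree_parent (F : {set {set T}}) (r : T) :
    F \in spanning_trees e ->
  exists (f : T -> T) (h : T -> nat),
    (forall x, x != r -> e x (f x) /\ (h (f x) < h x)%N) /\
    F = [set [set x; f x] | x in [set~ r]].
Proof.
rewrite inE => /and3P[Fe connF acyF].
have [f [h fh]] := connect_parent (fun x => forallP (forallP connF x) r).
exists f, h; split=> [x /fh[xF hx]|]; first by rewrite hx (edge_rel_sub Fe).
apply: acyclic_connected_minimal => //.
  by apply/subsetP => z /imsetP[x]; rewrite !inE => /fh[xF _] ->.
have reach : forall x, connect (edge_rel [set [set x; f x] | x in [set~ r]]) x r.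
  apply: (@rank_connect _ _ r f h) => x xr; split; last by case: (fh x xr).
  by apply: imset_f; rewrite !inE.
apply/forallP => x; apply/forallP => y.
apply: connect_trans (reach x) _.
by rewrite (sym_connect_sym (@edge_rel_sym _)) reach.
Qed.

(** Each choice function contributes 1 if it leads every vertex to [r] and 0 otherwise, and every
    spanning tree arises from one of the first kind. *)
Lemma num_spanning_trees_le_det (R : numDomainType) N (phi : 'I_N -> T) (r : 'I_N) :
    bijective phi ->
  (num_spanning_trees e)%:R <= \det (\matrix_(i, j)
    if i == r then (i == j)%:R
    else (deg e (phi i) * (i == j))%:R - (e (phi i) (phi j))%:R) :> R.
Proof.
case=> psi phiK psiK.
(* Row [i] of [L] is the sum of [e_i - e_k] over the neighbours [k] of [i]; row
   [r] is treated as having the single choice [k = r]. *)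
pose w i k := if i == r then k == r else e (phi i) (phi k).
set L := \matrix_(i, j) _.
have LE i j : L i j = \sum_k (w i k)%:R * ((i == j)%:R - ((i != r) && (k == j))%:R).
  rewrite mxE /w; have [->|ir] /= := eqVneq i r.
    rewrite (bigD1 r) //= eqxx mul1r subr0 big1 ?addr0 // => k /negbTE->.
    by rewrite mul0r.
  under eq_bigr => k _ do rewrite mulrBr.
  rewrite sumrB -mulr_suml -natr_sum natrM; congr (_%:R * _ - _).
    rewrite /deg -sum1_card (reindex phi) /=; last by exists psi => ? _.
    by rewrite big_mkcond; apply: eq_bigr => k _; rewrite inE; case: (e _ _).
  rewrite (bigD1 j) //= eqxx mulr1 big1 ?addr0 // => k /negbTE->.
  by rewrite mulr0.
have -> : \det L = \sum_(f : {ffun 'I_N -> 'I_N})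
    (\prod_i (w i (f i))%:R) * \det (parent_mx R r f).
  rewrite /determinant.
  under eq_bigr => s _.
    under eq_bigr => i _ do rewrite LE.
    rewrite bigA_distr_bigA /= mulr_sumr.
    over.
  rewrite exchange_big /=; apply: eq_bigr => f _.
  rewrite mulr_sumr; apply: eq_bigr => s _.
  rewrite big_split /= mulrCA; congr (_ * (_ * _)).
  by apply: eq_bigr => i _; rewrite mxE.
pose good := [set f : {ffun 'I_N -> 'I_N} |
  [forall i, w i (f i)] && [forall i, fconnect f i r]].
have card_good : (num_spanning_trees e <= #|good|)%N.
  pose E (f : {ffun 'I_N -> 'I_N}) :=
    [set [set phi i; phi (f i)] | i in [set~ r]].
  apply: leq_trans (leq_imset_card E good); apply/subset_leq_card/subsetP => F.
  case/(@spanning_tree_parent _ (phi r)) => f [h [fh FE]].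
  have fh' i : i != r -> e (phi i) (f (phi i)) /\ (h (f (phi i)) < h (phi i))%N.
    by move=> ir; apply: fh; rewrite (inj_eq (can_inj phiK)).
  (* The root is sent to itself, the only choice that [w] allows in row [r]. *)
  pose g := [ffun i => if i == r then r else psi (f (phi i))].
  apply/imsetP; exists g.
    rewrite inE; apply/andP; split; apply/forallP => i.
      rewrite /w ffunE; case: eqP => // /eqP ir; rewrite psiK.
      by case: (fh' i ir).
    apply: (@rank_connect _ _ r g (h \o phi)) => {}i ir; split=> //=.
    by rewrite ffunE (negbTE ir) psiK; case: (fh' i ir).
  rewrite FE /E; apply/setP => z; apply/imsetP/imsetP => -[x]; rewrite !inE => xr ->.
    exists (psi x); rewrite ?inE; first by rewrite -(inj_eq (can_inj phiK)) psiK.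
    rewrite ffunE -(inj_eq (can_inj phiK)) psiK (negbTE xr).
    by rewrite !psiK.
  exists (phi x); first by rewrite !inE (inj_eq (can_inj phiK)).
  by rewrite ffunE (negbTE xr) psiK.
apply: le_trans (_ : #|good|%:R <= _); first by rewrite ler_nat.
rewrite (bigID (mem good)) /= -sum1_card natr_sum -[leLHS]addr0.
apply: lerD.
  apply: ler_sum => f; rewrite inE => /andP[/forallP wf /forallP reach].
  by rewrite det_parent_mx_tree // mulr1 big1 // => i _; rewrite wf.
(* Outside [good], either a factor [w i (f i)] vanishes, or some vertex never reaches [r] and the
   determinant vanishes. *)
apply: sumr_ge0 => f; rewrite inE negb_and.
have [/forallP wf|/forallPn[i wi] _] /= := boolP [forall i, w i (f i)]; last first.
  by rewrite (bigD1 i) //= (negbTE wi) !mul0r.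
move=> /forallPn[i ir]; rewrite (det_parent_mx_cycle _ ir) ?mulr0 //.
by apply/eqP; have := wf r; rewrite /w eqxx.
Qed.

End SpanningTrees.

(** * Determinant identities *)

(** The block matrix is a unipotent upper factor times a lower triangular one whose diagonal blocks
    are the Schur complement and [D]. *)
Lemma det_block_schur (R : comUnitRingType) n m (A : 'M[R]_n) (B : 'M_(n, m))
    (C : 'M_(m, n)) (D : 'M_m) :
  D \in unitmx ->
  \det (block_mx A B C D) = \det D * \det (A - B *m invmx D *m C).
Proof.
move=> uD; rewrite mulrC -(det_lblock _ C).
rewrite -[RHS]mul1r -[X in X * _](_ : \det (block_mx 1%:M (B *m invmx D) 0 1%:M) = 1).
  by rewrite -det_mulmx mulmx_block !mul1mx !mul0mx !add0r subrK mulmxKV.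
by rewrite det_ublock !det1 mulr1.
Qed.

(** Eliminating either diagonal block of one bordered matrix computes the same determinant. *)
Lemma det_1D_mul (R : comUnitRingType) n (x : 'cV[R]_n) (y : 'rV_n) :
  \det (1%:M + x *m y) = 1 + (y *m x) 0 0.
Proof.
have <- : \det (block_mx 1%:M (- x) y 1%:M) = \det (1%:M + x *m y).
  by rewrite det_block_schur ?unitmx1 // det1 mul1r invmx1 mulmx1 mulNmx opprK.
have -> : block_mx 1%:M (- x) y 1%:M =
    block_mx 1%:M 0 y 1%:M *m block_mx 1%:M (- x) 0 (1%:M + y *m x).
  rewrite mulmx_block !mul1mx !mul0mx !addr0 mulmx1.
  by rewrite mulmxN addrCA addNr addr0.
by rewrite det_mulmx det_lblock det_ublock !det1 !mul1r det_mx11 !mxE.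
Qed.

(** By linearity in row [r], the difference of the two sides is the determinant of a matrix whose
    rows all sum to 0. *)
Lemma det_row_replace (R : idomainType) n (Q : 'M[R]_n) (r : 'I_n) (w : 'rV_n) :
    Q *m const_mx 1 = 0 :> 'cV_n ->
  \det (\matrix_(i, j) if i == r then w 0 j else Q i j) =
    (\sum_j w 0 j) *
    \det (\matrix_(i, j) if i == r then (i == j)%:R else Q i j).
Proof.
move=> Q1; set s := \sum_j _.
pose B := \matrix_(i, j) if i == r then w 0 j - s * (r == j)%:R else Q i j.
have detB : \det B = 0.
  apply/eqP; rewrite -det_tr; apply/det0P; exists (const_mx 1).
    by apply/eqP => /rowP/(_ r); rewrite !mxE => /eqP; rewrite oner_eq0.
  apply/rowP => i; rewrite !mxE; under eq_bigr => j _ do rewrite !mxE mul1r.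
  case: eqP => [_|_]; last first.
    move: Q1 => /colP/(_ i); rewrite !mxE; apply: etrans.
    by apply: eq_bigr => j _; rewrite mxE mulr1.
  have r1 : \sum_j (r == j)%:R = 1 :> R.
    by rewrite (bigD1 r) //= eqxx big1 ?addr0 // => j; rewrite eq_sym => /negbTE->.
  by rewrite sumrB -mulr_sumr r1 mulr1 subrr.
rewrite (@determinant_multilinear _ _ _ B
  (\matrix_(i, j) if i == r then (i == j)%:R else Q i j) r 1 s).
- by rewrite detB mulr0 add0r.
- by apply/rowP => j; rewrite !mxE eqxx mul1r subrK.
- by apply/matrixP => i j; rewrite !mxE eq_sym (negbTE (neq_lift _ _)).
- by apply/matrixP => i j; rewrite !mxE eq_sym (negbTE (neq_lift _ _)).
Qed.

(** Row operations give a factor [c * n] and leave an all-ones row [r]; replacing that row by a unit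
    vector gives the second [n]. *)
Lemma det_add_const (F : fieldType) n (Q : 'M[F]_n) (r : 'I_n) (c : F) :
    Q *m const_mx 1 = 0 :> 'cV_n -> const_mx 1 *m Q = 0 :> 'rV_n ->
  \det (Q + const_mx c) = c * n%:R ^+ 2 *
    \det (\matrix_(i, j) if i == r then (i == j)%:R else Q i j).
Proof.
move=> Q1 oQ; pose o : 'rV[F]_n := const_mx 1; pose e : 'cV[F]_n := delta_mx r 0.
have eo : o *m e = 1%:M.
  apply/matrixP => i j; rewrite !ord1 !mxE (bigD1 r) //= !mxE !eqxx mulr1.
  by rewrite big1 ?addr0 // => k /negbTE kr; rewrite !mxE kr mulr0.
have ee : e^T *m e = 1%:M.
  apply/matrixP => i j; rewrite !ord1 !mxE (bigD1 r) //= !mxE !eqxx mulr1.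
  by rewrite big1 ?addr0 // => k /negbTE kr; rewrite !mxE kr mulr0.
have oo : o *m o^T = n%:R%:M.
  apply/matrixP => i j; rewrite !ord1 !mxE.
  under eq_bigr => k _ do rewrite !mxE mulr1.
  by rewrite sumr_const card_ord.
have eoT : e^T *m o^T = 1%:M by rewrite -trmx_mul eo trmx1.
(* [U] is [Q] with row [r] replaced by the all-ones row [o]. *)
pose U := Q + e *m (o - e^T *m Q).
have cE : const_mx c = c *: (o^T *m o).
  by apply/matrixP => i j; rewrite !mxE big_ord1 !mxE !mulr1.
have eU : e^T *m U = o by rewrite mulmxDr mulmxA ee mul1mx addrC subrK.
(* Adding all rows of [Q + c J] to row [r] turns it into [c n o]. *)
have key : (1%:M + e *m (o - e^T)) *m (Q + const_mx c) =
    (1%:M + (c *: o^T + (c * n%:R - c - 1) *: e) *m e^T) *m U.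
  rewrite !mulmxDl !mul1mx -!mulmxA eU cE.
  rewrite mulmxDr mulmxBl oQ sub0r -scalemxAr mulmxA mulmxBl oo eoT.
  rewrite /U !mulmxDr !mulmxN !mulmxA.
  rewrite mulmxBl !mul_scalar_mx scale1r -!scalemxAr -!scalemxAl mulmxBr.
  rewrite -scalemxAr; move: (e *m o) (o^T *m o) (e *m e^T *m Q) => X Y Z.
  by apply/matrixP => i j; rewrite !mxE; ring.
have detF : \det (1%:M + e *m (o - e^T)) = 1.
  by rewrite det_1D_mul mulmxBl eo ee subrr mxE addr0.
(* The diagonal entry at [r] is 1 + c + (c n - c - 1) = c n; the other rows only add [c] times row
   [r] of [U]. *)
have detG : \det (1%:M + (c *: o^T + (c * n%:R - c - 1) *: e) *m e^T) = c * n%:R.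
  rewrite det_1D_mul mulmxDr -!scalemxAr eoT ee !mxE mulr1n.
  by ring.
rewrite -[LHS]mul1r -[X in X * _]detF -det_mulmx key det_mulmx detG.
have -> : U = \matrix_(i, j) if i == r then o 0 j else Q i j.
  apply/matrixP => i j; rewrite [LHS]mxE [in RHS]mxE mxE big_ord1.
  rewrite [(o - _) _ _]mxE [e _ _]mxE eqxx andbT.
  have -> : (- (e^T *m Q)) 0 j = - Q r j.
    rewrite mxE mxE (bigD1 r) //= !mxE eqxx mul1r big1 ?addr0 // => k /negbTE kr.
    by rewrite !mxE kr mul0r.
  by have [->|ir] := eqVneq i r; rewrite ?mul1r ?mul0r ?addr0 // addrC subrK.
rewrite det_row_replace //.
under [in LHS]eq_bigr => j _ do rewrite mxE.
by rewrite sumr_const card_ord mulrA expr2 mulrA.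
Qed.

(** * The spectral bound *)

(** A new term x replaces 1 + S by (1 - x)(1 + x + S) = 1 + S - x(x + S), which is no larger. *)
Lemma prod_1B_sum_le1 (R : numDomainType) (I : Type) (s : seq I) (x : I -> R) :
  (forall i, 0 <= x i <= 1) ->
  (\prod_(i <- s) (1 - x i)) * (1 + \sum_(i <- s) x i) <= 1.
Proof.
move=> x01; elim: s => [|i s IHs]; first by rewrite !big_nil addr0 mulr1.
rewrite !big_cons; apply: le_trans IHs.
set P := \prod_(_ <- _) _; set S := \sum_(_ <- _) _.
have P0 : 0 <= P by apply: prodr_ge0 => j _; rewrite subr_ge0; case/andP: (x01 j).
have S0 : 0 <= S by apply: sumr_ge0 => j _; case/andP: (x01 j).
have /andP[x0 _] := x01 i.
rewrite mulrAC mulrC; apply: ler_wpM2l => //.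
have -> : (1 - x i) * (1 + (x i + S)) = 1 + S - x i * (x i + S).
  by ring.
by rewrite gerBl mulr_ge0 ?addr_ge0.
Qed.

Section DoublyStochastic.

Variables (C : numClosedFieldType) (n : nat) (S : 'M[C]_n).
Hypotheses (n_gt0 : (0 < n)%N) (S_sym : S^T = S) (S_ge0 : forall i j, 0 <= S i j).
Hypothesis S_row : S *m const_mx 1 = const_mx 1 :> 'cV_n.
Hypothesis S_psd : forall v : 'rV_n, 0 <= (v *m S *m (v ^t* )%sesqui) 0 0.

(** [J] projects onto the constant vectors; subtracting it turns the eigenvalue 1 of [S] at the
    all-ones vector into 0. *)
Let J : 'M[C]_n := const_mx n%:R^-1.
Let R := S - J.

Let n_neq0 : n%:R != 0 :> C.
Proof. by rewrite pnatr_eq0 -lt0n. Qed.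

Let R1 : R *m const_mx 1 = 0 :> 'cV_n.
Proof.
rewrite mulmxBl S_row; apply/colP => i; rewrite !mxE.
under eq_bigr => j _ do rewrite !mxE mulr1.
by rewrite sumr_const card_ord -[X in _ - X]mulr_natl mulfV ?subrr.
Qed.

(** An eigenvector for a nonzero eigenvalue is orthogonal to the all-ones vector, hence also an
    eigenvector of [S]; positivity bounds [a] below and stochasticity above. *)
Let eigenvalue_R (v : 'rV_n) (a : C) :
  v *m (v ^t* )%sesqui = 1%:M -> v *m R = a *: v -> 0 <= a <= 1.
Proof.
move=> v1 vR; have [->|a0] := eqVneq a 0; first by rewrite lexx ler01.
have vo : v *m const_mx 1 = 0 :> 'M_1.
  apply: (scalerI a0); rewrite scalemxAl -vR -mulmxA R1 mulmx0.
  by rewrite scaler0.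
have vJ : v *m J = 0.
  have -> : J = (const_mx 1 : 'cV_n) *m (const_mx n%:R^-1 : 'rV_n).
    by apply/matrixP => i j; rewrite !mxE big_ord1 !mxE mul1r.
  by rewrite mulmxA vo mul0mx.
have vS : v *m S = a *: v by rewrite -vR mulmxBr vJ subr0.
have a_ge0 : 0 <= a.
  by have := S_psd v; rewrite vS -scalemxAl v1 !mxE mulr1.
rewrite a_ge0 /=.
have v_gt0 : 0 < \sum_j `|v 0 j|.
  rewrite lt_def sumr_ge0 ?andbT //; apply: contraTneq isT => v0.
  have v00 : v = 0.
    apply/rowP => j; rewrite mxE; apply/normr0_eq0.
    by move/psumr_eq0P: v0 => ->.
  by move/matrixP/(_ 0 0): v1; rewrite v00 mul0mx !mxE => /esym/eqP; rewrite oner_eq0.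
(* [S] does not increase the l^1 norm. *)
rewrite -(ler_pM2r v_gt0) mul1r mulr_sumr.
have -> : \sum_j a * `|v 0 j| = \sum_j `|\sum_k v 0 k * S k j|.
  apply: eq_bigr => j _; rewrite -{1}(ger0_norm a_ge0) -normrM.
  by have /rowP/(_ j) := vS; rewrite !mxE => ->.
apply: le_trans (_ : \sum_j \sum_k `|v 0 k| * S k j <= _).
  apply: ler_sum => j _; apply: le_trans (ler_norm_sum _ _ _) _.
  by apply: ler_sum => k _; rewrite normrM (ger0_norm (S_ge0 _ _)).
rewrite exchange_big /=; apply: ler_sum => k _.
rewrite -mulr_sumr; have /colP/(_ k) := S_row; rewrite !mxE.
by under eq_bigr => j _ do rewrite mxE mulr1; move=> ->; rewrite mulr1.
Qed.

(** [R] is real symmetric, hence unitarily diagonalizable. With eigenvalues x_i of [R], the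
    determinant is the product of the 1 - x_i, and the trace is 1 + sum x_i because [J] has trace
    1. *)
Lemma det_1B_trace_le1 : \det (1%:M - S + J) * \tr S <= 1.
Proof.
have R_normal : R \is normalmx.
  apply: symmetric_normalmx.
    apply/is_hermitianmxP; rewrite expr0 scale1r map_mx_id // linearB /= S_sym.
    by rewrite trmx_const.
  apply/mxOverP => i j; rewrite !mxE realB ?ger0_real //.
  by rewrite invr_ge0 ler0n.
have [/unitarymxP PP PU] := (spectral_unitarymx R, spectral_unit R).
have := orthomx_spectralP R_normal.
set P := spectralmx R in PP PU *; set sp := spectral_diag R => RE.
have sp01 i : 0 <= sp 0 i <= 1.
  apply: (@eigenvalue_R (row i P)).
    apply/matrixP => k l; rewrite !ord1.
    have /matrixP/(_ i i) := PP; rewrite !mxE eqxx => <-.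
    by apply: eq_bigr => j _; rewrite !mxE.
  rewrite -row_mul {1}RE !mulmxA mulmxV // mul1mx.
  by apply/rowP => j; rewrite mul_diag_mx !mxE.
have -> : 1%:M - S + J = invmx P *m diag_mx (const_mx 1 - sp) *m P.
  rewrite linearB /= diag_const_mx mulmxBr mulmxBl mulmx1 mulVmx // -RE.
  by rewrite opprB addrA addrAC.
have -> : \tr S = 1 + \sum_i sp 0 i.
  have -> : S = R + J by rewrite subrK.
  rewrite linearD /= addrC; congr (_ + _).
    rewrite /mxtrace; under eq_bigr => i _ do rewrite mxE.
    by rewrite sumr_const card_ord -[LHS]mulr_natl mulfV.
  by rewrite RE mxtrace_mulC mulmxA mulmxV // mul1mx mxtrace_diag.
have P0 : \det P != 0 by rewrite -unitfE -unitmxE.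
rewrite !det_mulmx det_inv [X in X * _]mulrC mulVKf //.
rewrite det_diag; under eq_bigr => i _ do rewrite !mxE.
exact: prod_1B_sum_le1.
Qed.

End DoublyStochastic.

(** * Bipartite graphs *)

Section Bipartite.

Variables (T : finType) (e : rel T).
Hypotheses (e_sym : symmetric e) (e_irr : irreflexive e).

Lemma bipartition_sym (A B : {set T}) : bipartition e A B -> bipartition e B A.
Proof.
move=> [ABT ABd ABe]; split; rewrite 1?setUC 1?disjoint_sym // => x y /ABe.
by rewrite orbC.
Qed.

Lemma deg_gt0 x y : graph_connected e -> x != y -> (0 < deg e x)%N.
Proof.
move=> /forallP/(_ x)/forallP/(_ y)/connectP[[|z p] /= exz yE xy].
  by rewrite yE eqxx in xy.
by case/andP: exz => exz _; apply/card_gt0P; exists z; rewrite inE.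
Qed.

Lemma bipartition_neq (A B : {set T}) x y :
  bipartition e A B -> x \in A -> y \in B -> x != y.
Proof.
move=> [_ ABd _] xA yB; apply: contraTneq yB => <-.
by rewrite (disjointFr ABd).
Qed.

Lemma bipartition_edge (A B : {set T}) x y :
  bipartition e A B -> x \in A -> e x y -> y \in B.
Proof.
move=> [_ ABd ABe] xA /ABe; rewrite xA (disjointFr ABd xA) andFb orbF.
by case/andP.
Qed.

Lemma sum_nbrs (R : pzSemiRingType) (A B : {set T}) x :
    bipartition e A B -> x \in A ->
  \sum_(j < #|B|) (e x (enum_val j))%:R = (deg e x)%:R :> R.
Proof.
move=> AB xA; transitivity (\sum_(y in B) (e x y)%:R : R).
  by rewrite [RHS]big_enum_val.
rewrite /deg -sum1_card natr_sum big_mkcond [RHS]big_mkcond /=.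
apply: eq_bigr => y _; rewrite inE.
case: ifPn; case: (boolP (e x y)) => // exy.
by rewrite (bipartition_edge AB xA exy).
Qed.

(** Numbering [A] before [B] gives the Laplacian its block form. *)
Definition bip_val (A B : {set T}) (k : 'I_(#|A| + #|B|)) : T :=
  match split k with inl i => enum_val i | inr j => enum_val j end.

Lemma bip_val_lshift (A B : {set T}) (i : 'I_#|A|) :
  bip_val (lshift #|B| i) = enum_val i.
Proof. by rewrite /bip_val (unsplitK (inl i)). Qed.

Lemma bip_val_rshift (A B : {set T}) (j : 'I_#|B|) :
  bip_val (rshift #|A| j) = enum_val j.
Proof. by rewrite /bip_val (unsplitK (inr j)). Qed.

Lemma bip_val_bij (A B : {set T}) : bipartition e A B -> bijective (@bip_val A B).
Proof.
move=> AB; apply: inj_card_bij => [k l|].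
  case: (split_ordP k) => i ->; case: (split_ordP l) => j ->;
    rewrite ?bip_val_lshift ?bip_val_rshift => ij.
  - by rewrite (enum_val_inj ij).
  - by have := bipartition_neq AB (enum_valP i) (enum_valP j); rewrite ij eqxx.
  - by have := bipartition_neq AB (enum_valP j) (enum_valP i); rewrite ij eqxx.
  - by rewrite (enum_val_inj ij).
have [ABT ABd _] := AB.
by rewrite card_ord -(cardsUI A B) ABT (disjoint_setI0 ABd) cards0 addn0 cardsT.
Qed.

Lemma deg_prod_bip (A B : {set T}) : bipartition e A B ->
  deg_prod e = (\prod_(i < #|A|) deg e (enum_val i) *
                \prod_(j < #|B|) deg e (enum_val j))%N.
Proof.
move=> AB; rewrite /deg_prod (reindex _ (onW_bij _ (bip_val_bij AB))) /=.
rewrite big_split_ord /=.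
by congr (_ * _)%N; apply: eq_bigr => i _; rewrite ?bip_val_lshift ?bip_val_rshift.
Qed.

Section Regular.

Variables (C : numClosedFieldType) (A B : {set T}) (d : nat).
Hypotheses (e_conn : graph_connected e) (AB : bipartition e A B).
Hypotheses (A_gt0 : (0 < #|A|)%N) (B_gt0 : (0 < #|B|)%N).
Hypothesis A_reg : forall x, x \in A -> deg e x = d.

Let n := #|A|.
Let m := #|B|.
Let r : 'I_n := Ordinal A_gt0.
Let M : 'M[C]_(n, m) := \matrix_(i, j) (e (enum_val i) (enum_val j))%:R.
Let b : 'rV[C]_m := \row_j (deg e (enum_val j))%:R.
Let Db' : 'M[C]_m := diag_mx (\row_j (b 0 j)^-1).
(** Divided by [d], this is the transition matrix of the two-step random walk on [A]. *)
Let P : 'M[C]_n := M *m Db' *m M^T.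
Let Q : 'M[C]_n := d%:R%:M - P.

Let d_neq0 : d%:R != 0 :> C.
Proof.
rewrite pnatr_eq0 -lt0n -(A_reg (enum_valP r)).
exact: deg_gt0 e_conn (bipartition_neq AB (enum_valP r) (enum_valP (Ordinal B_gt0))).
Qed.

Let b_gt0 j : 0 < b 0 j.
Proof.
rewrite mxE ltr0n; apply: (deg_gt0 (y := enum_val r)) => //.
by rewrite eq_sym (bipartition_neq AB) ?enum_valP.
Qed.

Let b_unit : diag_mx b \in unitmx.
Proof.
by rewrite unitmxE unitfE det_diag; apply/prodf_neq0 => j _; rewrite gt_eqF.
Qed.

Let invmx_b : invmx (diag_mx b) = Db'.
Proof.
rewrite -[LHS]mulmx1 -(_ : diag_mx b *m Db' = 1%:M) ?mulKmx //.
rewrite mulmx_diag -diag_const_mx; congr diag_mx.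
by apply/rowP => j; have := b_gt0 j; rewrite !mxE => bj; rewrite mulfV // gt_eqF.
Qed.

Let M1 : M *m const_mx 1 = const_mx d%:R :> 'cV_n.
Proof.
apply/colP => i; rewrite !mxE -(A_reg (enum_valP i)) -(sum_nbrs _ AB (enum_valP i)).
by apply: eq_bigr => j _; rewrite !mxE mulr1.
Qed.

Let MT1 : M^T *m const_mx 1 = b^T :> 'cV_m.
Proof.
apply/colP => j; rewrite !mxE -(sum_nbrs _ (bipartition_sym AB) (enum_valP j)).
by apply: eq_bigr => i _; rewrite !mxE mulr1 e_sym.
Qed.

Let P1 : P *m const_mx 1 = const_mx d%:R :> 'cV_n.
Proof.
rewrite -!mulmxA MT1 (_ : Db' *m b^T = const_mx 1) ?M1 //.
apply/colP => j; have := b_gt0 j; rewrite mul_diag_mx !mxE => bj.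
by rewrite mulVf // gt_eqF.
Qed.

Let P_sym : P^T = P.
Proof. by rewrite !trmx_mul trmxK tr_diag_mx mulmxA. Qed.

Let Q1 : Q *m const_mx 1 = 0 :> 'cV_n.
Proof.
by rewrite mulmxBl P1 mul_scalar_mx; apply/colP => i; rewrite !mxE mulr1 subrr.
Qed.

Let oQ : const_mx 1 *m Q = 0 :> 'rV_n.
Proof.
apply: trmx_inj; rewrite trmx_mul linearB /= P_sym tr_scalar_mx trmx_const trmx0.
exact: Q1.
Qed.

(** Each vertex of [B] contributes its degree divided by itself, as the entries of [M] are 0 or
    1. *)
Let trP : \tr P = m%:R.
Proof.
rewrite mxtrace_mulC mulmxA /mxtrace -[m in RHS]card_ord -sum1_card natr_sum.
apply: eq_bigr => j _; rewrite mul_mx_diag mxE [X in _ * X]mxE.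
have -> : (M^T *m M) j j = b 0 j.
  have /colP/(_ j) := MT1; rewrite [in RHS]mxE => <-; rewrite !mxE.
  by apply: eq_bigr => i _; rewrite !mxE -natrM mulnb andbb mulr1.
by rewrite mulfV // gt_eqF.
Qed.

Let detQ : \det (\matrix_(i, j) if i == r then (i == j)%:R else Q i j) * (n * m)%:R
  <= d%:R ^+ n.
Proof.
pose S := d%:R^-1 *: P.
have S_sym : S^T = S by rewrite linearZ /= P_sym.
have S_ge0 i j : 0 <= S i j.
  rewrite mxE mulr_ge0 ?invr_ge0 ?ler0n // mxE sumr_ge0 // => k _.
  by rewrite mul_mx_diag !mxE !mulr_ge0 ?ler0n // invr_ge0 ler0n.
have S_row : S *m const_mx 1 = const_mx 1 :> 'cV_n.
  by rewrite -scalemxAl P1; apply/colP => i; rewrite !mxE mulVf.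
have S_psd (v : 'rV_n) : 0 <= (v *m S *m (v ^t* )%sesqui) 0 0.
  rewrite -scalemxAr -scalemxAl mxE mulr_ge0 ?invr_ge0 ?ler0n //.
  (* With u = v M the form is the sum of |u_j|^2 / b_j. *)
  have -> : v *m P *m (v ^t* )%sesqui = (v *m M) *m Db' *m ((v *m M) ^t* )%sesqui.
    rewrite trmx_mul map_mxM !mulmxA; congr (_ *m _ *m _ ).
    by apply/matrixP => i j; rewrite !mxE rmorph_nat.
  move: (v *m M) => u; rewrite mxE sumr_ge0 // => j _; rewrite mul_mx_diag.
  have := b_gt0 j; rewrite !mxE => bj.
  by rewrite mulrAC mulr_ge0 ?mul_conjC_ge0 // invr_ge0 ltW.
have := det_1B_trace_le1 A_gt0 S_sym S_ge0 S_row S_psd.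
have n_neq0 : n%:R != 0 :> C by rewrite pnatr_eq0 -lt0n.
(* The constant d/n makes the perturbed [Q] equal to [d] times the matrix of [det_1B_trace_le1]. *)
have := det_add_const r (d%:R / n%:R) Q1 oQ.
have -> : Q + const_mx (d%:R / n%:R) =
    d%:R *: (1%:M - S + const_mx n%:R^-1).
  rewrite scalerDr scalerBr scale_scalar_mx mulr1 scalerA divff // scale1r.
  by congr (_ + _); apply/matrixP => i j; rewrite !mxE.
have -> : \tr S = d%:R^-1 * m%:R by rewrite /S mxtraceZ trP.
rewrite detZ.
set x := \det _; set y := \det _ => xy yle.
have d_gt0 : 0 < d%:R :> C by rewrite lt_def d_neq0 ler0n.
rewrite -[leRHS]mulr1; apply: le_trans (ler_wpM2l (exprn_ge0 n (ltW d_gt0)) yle).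
rewrite mulrA xy natrM le_eqVlt; apply/orP; left; apply/eqP.
by field; rewrite n_neq0 d_neq0.
Qed.

Lemma num_spanning_trees_le_regular :
  (num_spanning_trees e)%:R * (n * m)%:R <= (deg_prod e)%:R :> C.
Proof.
(* Taking the root in [A] keeps the block of [B] equal to the invertible [diag_mx b]. *)
have := num_spanning_trees_le_det e_sym e_irr C (lshift _ r) (bip_val_bij AB).
set L := \matrix_(i, j) _.
have A0 i j : e (enum_val (i : 'I_n)) (enum_val (j : 'I_n)) = false.
  apply: contraTF isT => eij.
  have := bipartition_neq AB (enum_valP j) (bipartition_edge AB (enum_valP i) eij).
  by rewrite eqxx.
have B0 i j : e (enum_val (i : 'I_m)) (enum_val (j : 'I_m)) = false.
  apply: contraTF isT => eij; have BA := bipartition_sym AB.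
  have := bipartition_neq BA (enum_valP j) (bipartition_edge BA (enum_valP i) eij).
  by rewrite eqxx.
have -> : L = block_mx (\matrix_(i, j) if i == r then (i == j)%:R else d%:R%:M i j)
    (\matrix_(i, j) if i == r then 0 else - M i j) (- M^T) (diag_mx b).
  apply/matrixP => i j; rewrite mxE.
  case: (split_ordP i) => {}i ->; case: (split_ordP j) => {}j ->;
    rewrite ?block_mxEul ?block_mxEur ?block_mxEdl ?block_mxEdr !mxE
      ?bip_val_lshift ?bip_val_rshift ?eq_lshift ?eq_rshift ?eq_lrshift
      ?eq_rlshift.
  - by rewrite A0 subr0 (A_reg (enum_valP i)) natrM mulr_natr.
  - by rewrite muln0 sub0r.
  - by rewrite muln0 sub0r e_sym.
  - by rewrite B0 subr0 natrM mulr_natr.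
rewrite det_block_schur // invmx_b det_diag.
(* Row [r] of the upper right block is 0, so elimination leaves the unit row [r] untouched. *)
set Qr := _ - _; have {Qr}-> : Qr = \matrix_(i, j) if i == r then (i == j)%:R else Q i j.
  apply/matrixP => i j; rewrite /Qr mxE [(- (_ *m _ *m _)) i j]mxE -mulmxA.
  rewrite [((\matrix_(_, _) _) *m _) i j]mxE [in X in X - _]mxE [in RHS]mxE.
  have [->|ir] := eqVneq i r.
    by rewrite big1 ?subr0 // => k _; rewrite mxE eqxx mul0r.
  rewrite [Q i j]mxE [(- P) i j]mxE; congr (_ - _).
  rewrite /P -mulmxA [in RHS]mxE.
  apply: eq_bigr => k _; rewrite [X in X * _]mxE (negbTE ir) mulmxN.
  by rewrite [X in _ * X]mxE mulrNN.
move=> tau_le; apply: le_trans (ler_wpM2r (ler0n _ _) tau_le) _.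
rewrite -mulrA (deg_prod_bip AB) [leRHS]natrM [leRHS]mulrC.
have -> : (\prod_(i < #|A|) deg e (enum_val i))%:R = d%:R ^+ n :> C.
  rewrite natr_prod; under eq_bigr => i _ do rewrite (A_reg (enum_valP i)).
  by rewrite prodr_const card_ord.
rewrite natr_prod; under eq_bigr => j _ do rewrite mxE.
by apply: ler_wpM2l detQ; apply: prodr_ge0 => j _; apply: ler0n.
Qed.

End Regular.

End Bipartite.

Theorem theorem2 (T : finType) (e : rel T) (A B : {set T}) (n m : nat)
    (e_sym : symmetric e) (e_irr : irreflexive e)
    (e_conn : graph_connected e) (AB_bip : bipartition e A B)
    (card_A : #|A| = n) (card_B : #|B| = m)
    (n_gt0 : (0 < n)%N) (m_gt0 : (0 < m)%N)
    (e_reg : one_side_regular e A B) :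
  (num_spanning_trees e)%:R <= (deg_prod e)%:R / (m%:R * n%:R) :> rat.
Proof.
(* With denominators cleared the inequality is one of naturals, so it can be moved to [algC], where
   the spectral theorem applies. *)
rewrite ler_pdivlMr ?mulr_gt0 ?ltr0n // -!natrM ler_nat -(ler_nat algC) natrM.
subst n m; case: e_reg => -[d reg].
  by rewrite mulnC; apply: num_spanning_trees_le_regular AB_bip _ _ reg.
exact: num_spanning_trees_le_regular (bipartition_sym AB_bip) _ _ reg.
Qed.
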